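(* Consider the linear model $Y=X\beta+\epsilon$ described in the context, with $S=\mathrm{supp}(\beta)$, $s=|S|$, $\lambda=\sqrt{2\log p/n}$, $s_0$ as defined there, and $T_0$ the locations of the $s_0$ largest coefficients of $\beta$ in absolute value. Suppose that $RE(s_0,6,X)$ holds with constant $K(s_0,6)$, and that $\Lambda_{\min}(2s)>0$ and $\Lambda_{\max}(2s)<\infty$. Let $a\ge0$, $d_0\ge2\sqrt{1+a}$, and let $\beta_{\rm init}$ be an optimal solution to the Lasso with parameter $\lambda_n=d_0\lambda\sigma\ (\ge2\lambda_{\sigma,a,p})$. Let $h=\beta_{\rm init}-\beta_{T_0}$ and $\Lambda_{\max}:=\Lambda_{\max}(s-s_0)$. Then on $\mathcal T_a$, $$\|\beta_{\rm init}-\beta\|_2^2\le2\lambda^2\sigma^2s_0(D_0^2+D_1^2+1),$$ $$\|h_{T_0}\|_1+\|\beta_{{\rm init},T_0^c}\|_1\le\Bigl(\frac{2\Lambda_{\max}}{d_0}+\max\Bigl\{8K^2(s_0,6)d_0,\ \frac{\Lambda_{\max}}{3d_0}\Bigr\}\Bigr)\lambda\sigma s_0,$$ $$\frac{\|X\beta_{\rm init}-X\beta\|_2}{\sqrt n}\le\lambda\sigma\sqrt{s_0}\,\bigl(\sqrt{\Lambda_{\max}}+3d_0K(s_0,6)\bigr),$$ where $D_0,D_1$ are defined in the context. Moreover, on $\mathcal T_a$, for any subset $I_0\subset S$ such that $RE(|I_0|,6,X)$ holds with constant $K(|I_0|,6)$, $$\frac{\|X\beta_{\rm init}-X\beta\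|_2^2}{n}\le\frac{2\|X\beta-X\beta_{I_0}\|_2^2}{n}+9\lambda_n^2\,|I_0|\,K^2(|I_0|,6).$$
   Context: Model. $p\ge n$; $X$ is a fixed real $n\times p$ matrix whose columns all have $\ell_2$ norm $\sqrt n$; $\beta\in\mathbb R^p$; $\epsilon\sim N(0,\sigma^2I_n)$ with $\sigma>0$; $Y=X\beta+\epsilon$; $\mathrm{supp}(\beta)=\{j:\beta_j\ne0\}$. For $T\subseteq\{1,\dots,p\}$, $X_T$ is the submatrix of columns indexed by $T$; $v_T$ is the restriction of $v$ to $T$, also identified with its extension by zero to $\mathbb R^p$. $s_0$ is the smallest integer with $\sum_{i=1}^p\min(\beta_i^2,\lambda^2\sigma^2)\le s_0\lambda^2\sigma^2$. Event. $\lambda_{\sigma,a,p}=\sigma\sqrt{1+a}\sqrt{2\log p/n}$ and $\mathcal T_a=\{\epsilon:\|X^T\epsilon/n\|_\infty\le\lambda_{\sigma,a,p}\}$. ''On $\mathcal T_a$'' means for every realization $\epsilon\in\mathcal T_a$. Lasso with parameter $\lambda_n$: minimize $\frac1{2n}\|Y-Xb\|_2^2+\lambda_n\|b\|_1$ over $b\in\mathbb R^p$. $\Lambda_{\min}(m)$, $\Lambda_{\max}(m)$: minimum and maximum of $\|Xv\|_2^2/(n\|v\|_2^2)$ over nonzero $v$ with at most $m$ nonzero entries (convention $\Lambda_{\max}(0)=0$). $\theta_{m,m'}$: smallest number with $|\langle X_Tc,X_{T'}c'\rangle|/n\le\theta_{m,m'}\|c\|_2\|c'\|_2$ for all disjoint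 $T,T'$ with $|T|\le m$, $|T'|\le m'$ and all $c,c'$. $RE(m,k_0,X)$ for an integer $m\geq 1$: $\frac1{K(m,k_0)}:=\min_{|J_0|\le m}\min_{v\ne0,\,\|v_{J_0^c}\|_1\le k_0\|v_{J_0}\|_1}\frac{\|Xv\|_2}{\sqrt n\|v_{J_0}\|_2}>0$. Constants, with $K=K(s_0,6)$: $$D=(\sqrt2+1)\frac{\sqrt{\Lambda_{\max}(s-s_0)}}{\sqrt{\Lambda_{\min}(2s_0)}}+\frac{\theta_{s_0,2s_0}\Lambda_{\max}(s-s_0)}{\Lambda_{\min}(2s_0)},\qquad D_0=\max\bigl\{D,\ K\sqrt2\,(2\sqrt{\Lambda_{\max}(s-s_0)}+3d_0K)\bigr\},$$ $$D_1=\frac{2\Lambda_{\max}(s-s_0)}{d_0}+\frac{9K^2d_0}{2}.$$ *)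

(* Defs.v *)
From HB Require Import structures.
From mathcomp Require Import all_boot all_order all_algebra.
From mathcomp Require Import all_classical all_reals all_analysis.

Set Implicit Arguments.
Unset Strict Implicit.
Unset Printing Implicit Defensive.

Import Order.TTheory GRing.Theory Num.Theory.
Import numFieldNormedType.Exports.

Local Open Scope classical_set_scope.
Local Open Scope ring_scope.

Definition l1norm (R : realType) (m : nat) (v : 'cV[R]_m) : R :=
  \sum_(j < m) `|v j 0|.

Definition l2norm (R : realType) (m : nat) (v : 'cV[R]_m) : R :=
  Num.sqrt (\sum_(j < m) v j 0 ^+ 2).

Definition inner (R : realType) (m : nat) (u v : 'cV[R]_m) : R :=
  \sum_(j < m) u j 0 * v j 0.

Definition supp (R : realType) (p : nat) (v : 'cV[R]_p) : {set 'I_p} :=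
  [set j | v j 0 != 0]%SET.

(* v_T, extended by zero; X_T c is represented by X *m restr T c. *)
Definition restr (R : realType) (p : nat) (T : {set 'I_p}) (v : 'cV[R]_p) :
    'cV[R]_p :=
  \col_j (if j \in T then v j 0 else 0).

(* eps ~ N(0, sigma^2 I_n): the joint law of the coordinates is the n-fold
   product of N(0, sigma^2) (given on measurable rectangles, which determine
   it).  The second parameter of normal_prob is the standard deviation. *)
Definition gaussian_noise (R : realType) (d : measure_display)
    (Omega : measurableType d) (P : probability Omega R) (n : nat) (sigma : R)
    (eps : 'I_n -> {RV P >-> R}) : Prop :=
  forall B : 'I_n -> set R, (forall i, measurable (B i)) ->
    P [set w | forall i, B i (eps i w)] =
    (\prod_(i < n) normal_prob 0 sigma (B i))%E.

Definition realization (R : realType) (d : measure_display)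
    (Omega : measurableType d) (P : probability Omega R) (n : nat)
    (eps : 'I_n -> {RV P >-> R}) (w : Omega) : 'cV[R]_n :=
  \col_i eps i w.

Definition lambda0 (R : realType) (n p : nat) : R :=
  Num.sqrt (2 * ln p%:R / n%:R).

Definition lambda_noise (R : realType) (n p : nat) (sigma a : R) : R :=
  sigma * Num.sqrt (1 + a) * lambda0 R n p.

(* The norm of a matrix in the library is the entrywise sup norm. *)
Definition noise_event (R : realType) (n p : nat) (X : 'M[R]_(n, p))
    (sigma a : R) : set 'cV[R]_n :=
  [set e | `|n%:R^-1 *: (X^T *m e)| <= lambda_noise n p sigma a].

(* A natural number suffices for "smallest integer": the left-hand side is
   nonnegative, and lambda * sigma > 0 as soon as p >= 2; when lambda = 0 no
   smallest integer exists, this predicate gives s0 = 0, and RE below fails. *)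
Definition is_s0 (R : realType) (p : nat) (beta : 'cV[R]_p) (lambda sigma : R)
    (s0 : nat) : Prop :=
  let bounded (m : nat) :=
    \sum_(i < p) Num.min (beta i 0 ^+ 2) (lambda ^+ 2 * sigma ^+ 2)
      <= m%:R * lambda ^+ 2 * sigma ^+ 2 in
  bounded s0 /\ forall m : nat, bounded m -> (s0 <= m)%N.

(* Ties in absolute value may be broken arbitrarily. *)
Definition largest_locations (R : realType) (p : nat) (beta : 'cV[R]_p)
    (m : nat) (T : {set 'I_p}) : Prop :=
  #|T| = m /\ forall i j, i \in T -> j \notin T -> `|beta j 0| <= `|beta i 0|.

Definition lasso_objective (R : realType) (n p : nat) (X : 'M[R]_(n, p))
    (Y : 'cV[R]_n) (lambda : R) (b : 'cV[R]_p) : R :=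
  (2 * n%:R)^-1 * l2norm (Y - X *m b) ^+ 2 + lambda * l1norm b.

Definition lasso_solution (R : realType) (n p : nat) (X : 'M[R]_(n, p))
    (Y : 'cV[R]_n) (lambda : R) (b : 'cV[R]_p) : Prop :=
  forall b' : 'cV[R]_p,
    lasso_objective X Y lambda b <= lasso_objective X Y lambda b'.

Definition sparse_quotients (R : realType) (n p : nat) (X : 'M[R]_(n, p))
    (m : nat) : set R :=
  [set q | exists v : 'cV[R]_p, [/\ v != 0, (#|supp v| <= m)%N &
     q = l2norm (X *m v) ^+ 2 / (n%:R * l2norm v ^+ 2)]].

Definition Lambda_min (R : realType) (n p : nat) (X : 'M[R]_(n, p)) (m : nat) :
    R :=
  inf (sparse_quotients X m).

(* Lambda_max X 0 = 0, since sup set0 = 0. *)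
Definition Lambda_max (R : realType) (n p : nat) (X : 'M[R]_(n, p)) (m : nat) :
    R :=
  sup (sparse_quotients X m).

Definition theta (R : realType) (n p : nat) (X : 'M[R]_(n, p)) (m m' : nat) :
    R :=
  inf [set t | forall (T T' : {set 'I_p}) (c c' : 'cV[R]_p),
    [disjoint T & T']%B -> (#|T| <= m)%N -> (#|T'| <= m')%N ->
    `|inner (X *m restr T c) (X *m restr T' c')| / n%:R
      <= t * l2norm (restr T c) * l2norm (restr T' c')].

(* For v in the cone, v != 0 forces v_J != 0: no quotient is degenerate. *)
Definition RE_quotients (R : realType) (n p : nat) (X : 'M[R]_(n, p))
    (m : nat) (k0 : R) : set R :=
  [set q | exists (J : {set 'I_p}) (v : 'cV[R]_p),
    [/\ (#|J| <= m)%N, v != 0,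
        l1norm (restr (~: J)%SET v) <= k0 * l1norm (restr J v) &
        q = l2norm (X *m v) / (Num.sqrt n%:R * l2norm (restr J v))]].

Definition RE (R : realType) (n p : nat) (X : 'M[R]_(n, p)) (m : nat)
    (k0 : R) : Prop :=
  (1 <= m)%N /\ 0 < inf (RE_quotients X m k0).

Definition RE_const (R : realType) (n p : nat) (X : 'M[R]_(n, p)) (m : nat)
    (k0 : R) : R :=
  (inf (RE_quotients X m k0))^-1.

Definition D_cst (R : realType) (n p : nat) (X : 'M[R]_(n, p)) (s s0 : nat) :
    R :=
  (Num.sqrt 2 + 1) * (Num.sqrt (Lambda_max X (s - s0)) /
                      Num.sqrt (Lambda_min X (2 * s0)))
  + theta X s0 (2 * s0) * Lambda_max X (s - s0) / Lambda_min X (2 * s0).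

Definition D0_cst (R : realType) (n p : nat) (X : 'M[R]_(n, p)) (s s0 : nat)
    (d0 : R) : R :=
  let K := RE_const X s0 6 in
  Num.max (D_cst X s s0)
    (K * Num.sqrt 2 * (2 * Num.sqrt (Lambda_max X (s - s0)) + 3 * d0 * K)).

Definition D1_cst (R : realType) (n p : nat) (X : 'M[R]_(n, p)) (s s0 : nat)
    (d0 : R) : R :=
  let K := RE_const X s0 6 in
  2 * Lambda_max X (s - s0) / d0 + 9 * K ^+ 2 * d0 / 2.

(* Main.v *)
Require Import Defs.
From HB Require Import structures.
From mathcomp Require Import all_boot all_order all_algebra.
From mathcomp Require Import all_classical all_reals all_analysis.
From mathcomp Require Import ring lra.

Import Order.TTheory GRing.Theory Num.Theory.
Import numFieldNormedType.Exports.

Local Open Scope classical_set_scope.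
Local Open Scope ring_scope.

(* Comparing b = beta_init with the truncation beta_J through the variational
   inequality of the Lasso gives, with h = b - beta_J, nu = |X h|_2 / sqrt n and
   A = |X (beta - beta_J)|_2^2 / n, the oracle inequality
     |X (b - beta)|_2^2 / n + nu^2 + lambda_n |h_{J^c}|_1 <= A + 3 lambda_n |h_J|_1.
   Either h lies in the cone |h_{J^c}|_1 <= 6 |h_J|_1, where RE gives
   |h_J|_1 <= sqrt |J| K nu and the right-hand side is absorbed by completing a
   square, or the term 3 lambda_n |h_J|_1 is absorbed by the left-hand side.
   For J = T0 one has A <= Lambda_max (lambda sigma)^2 s0.  In l2, the part of h
   outside T0 and its s0 next largest entries is controlled by |h_{T0^c}|_1,
   and the remaining 2 s0 entries by RE inside the cone, and outside it by
   Lambda_min(2 s0) and theta after splitting the tail into blocks. *)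

(** * Inner product and norms on column vectors *)

Section Euclidean.
Context {R : realType} {m : nat}.
Implicit Types u v w : 'cV[R]_m.

Lemma innerC u v : inner u v = inner v u.
Proof. by apply: eq_bigr => j _; rewrite mulrC. Qed.

Lemma innerDl u v w : inner (u + v) w = inner u w + inner v w.
Proof. by rewrite -big_split; apply: eq_bigr => j _; rewrite mxE mulrDl. Qed.

Lemma innerZl (k : R) u v : inner (k *: u) v = k * inner u v.
Proof. by rewrite /inner mulr_sumr; apply: eq_bigr => j _; rewrite mxE mulrA. Qed.

Lemma innerNl u v : inner (- u) v = - inner u v.
Proof. by rewrite -scaleN1r innerZl mulN1r. Qed.

Lemma innerDr u v w : inner u (v + w) = inner u v + inner u w.
Proof. by rewrite innerC innerDl !(innerC u). Qed.

Lemma innerNr u v : inner u (- v) = - inner u v.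
Proof. by rewrite innerC innerNl innerC. Qed.

Lemma innerZr (k : R) u v : inner u (k *: v) = k * inner u v.
Proof. by rewrite innerC innerZl innerC. Qed.

Definition innerE := (innerDl, innerDr, innerZl, innerZr, innerNl, innerNr).

Lemma inner_ge0 v : 0 <= inner v v.
Proof. by apply: sumr_ge0 => j _; rewrite -expr2 sqr_ge0. Qed.

Lemma sqr_l2norm v : l2norm v ^+ 2 = inner v v.
Proof.
rewrite /l2norm sqr_sqrtr; last by apply: sumr_ge0 => j _; exact: sqr_ge0.
by apply: eq_bigr => j _; rewrite expr2.
Qed.

Lemma l2norm_ge0 v : 0 <= l2norm v.
Proof. exact: sqrtr_ge0. Qed.

Lemma l1norm_ge0 v : 0 <= l1norm v.
Proof. by apply: sumr_ge0. Qed.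

Lemma inner_eq0 v : (inner v v == 0) = (v == 0).
Proof.
apply/eqP/eqP => [v0|->]; last first.
  by rewrite /inner big1 // => j _; rewrite mxE mul0r.
apply/colP => j; rewrite mxE; apply/eqP; rewrite -sqrf_eq0 expr2; apply/eqP.
move: v0 => /eqP; rewrite psumr_eq0 => [/allP/(_ j)|i _]; last by rewrite -expr2 sqr_ge0.
by rewrite mem_index_enum => /(_ isT)/eqP.
Qed.

Lemma l2norm_eq0 v : (l2norm v == 0) = (v == 0).
Proof. by rewrite -sqrf_eq0 sqr_l2norm inner_eq0. Qed.

Lemma l2norm0 : l2norm (0 : 'cV[R]_m) = 0.
Proof. by apply/eqP; rewrite l2norm_eq0. Qed.

Lemma l2norm_gt0 v : (0 < l2norm v) = (v != 0).
Proof. by rewrite lt_def l2norm_eq0 l2norm_ge0 andbT. Qed.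

(** The squared norm of [inner v v *: u - inner u v *: v] is [inner v v] times the gap between the
    two sides. *)
Lemma cauchy_schwarz u v : inner u v ^+ 2 <= inner u u * inner v v.
Proof.
have [->|v0] := eqVneq v 0.
  by rewrite -(scale0r u) !innerZr !mul0r mulr0 expr0n.
have vv : 0 < inner v v by rewrite lt_def inner_eq0 v0 inner_ge0.
have := inner_ge0 (inner v v *: u - inner u v *: v).
rewrite !innerE (innerC v u) => H.
rewrite -subr_ge0 -(pmulr_rge0 _ vv); apply: le_trans H _; rewrite le_eqVlt.
by apply/orP; left; apply/eqP; ring.
Qed.

Lemma normr_inner_le u v : `|inner u v| <= l2norm u * l2norm v.
Proof.
rewrite -(ler_pXn2r (ltn0Sn 1)) ?nnegrE ?mulr_ge0 ?l2norm_ge0//.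
by rewrite real_normK ?num_real// exprMn !sqr_l2norm cauchy_schwarz.
Qed.

Lemma l2normD u v : l2norm (u + v) <= l2norm u + l2norm v.
Proof.
rewrite -(ler_pXn2r (ltn0Sn 1)) ?nnegrE ?addr_ge0 ?l2norm_ge0//.
rewrite sqrrD !sqr_l2norm !innerE (innerC v u).
have := le_trans (ler_norm _) (normr_inner_le u v); lra.
Qed.

Lemma l2normB_sqr u v :
  l2norm (u - v) ^+ 2 <= 2 * l2norm u ^+ 2 + 2 * l2norm v ^+ 2.
Proof.
rewrite !sqr_l2norm; have := inner_ge0 (u + v); rewrite !innerE; lra.
Qed.

End Euclidean.

(** * Restriction to an index set *)

Section Restriction.
Context {R : realType} {p : nat}.
Implicit Types (v : 'cV[R]_p) (T U : {set 'I_p}).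

Lemma l1norm_restr T v : l1norm (restr T v) = \sum_(j in T) `|v j 0|.
Proof.
rewrite [RHS]big_mkcond; apply: eq_bigr => j _; rewrite mxE.
by case: ifP => // _; rewrite normr0.
Qed.

Lemma sqr_l2norm_restr T v : l2norm (restr T v) ^+ 2 = \sum_(j in T) v j 0 ^+ 2.
Proof.
rewrite sqr_l2norm [RHS]big_mkcond; apply: eq_bigr => j _; rewrite mxE.
by case: ifP => // _; rewrite mul0r.
Qed.

Lemma restrC T v : restr T v + restr (~: T) v = v.
Proof.
by apply/colP => j; rewrite !mxE inE; case: ifP => _ /=; rewrite ?addr0 ?add0r.
Qed.

Lemma subr_restr T v : v - restr T v = restr (~: T) v.
Proof. by rewrite -[X in X - _](restrC T) addrC addKr. Qed.

Lemma l1norm_restrC T v : l1norm (restr T v) + l1norm (restr (~: T) v) = l1norm v.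
Proof.
rewrite !l1norm_restr /l1norm [RHS](bigID (mem T)) /=; congr (_ + _).
by apply: eq_bigl => j; rewrite inE.
Qed.

Lemma l1norm_restrD U T v : T \subset U ->
  l1norm (restr T v) + l1norm (restr (U :\: T) v) = l1norm (restr U v).
Proof.
by move=> TU; rewrite !l1norm_restr [RHS](big_setID T) /= (finset.setIidPr TU).
Qed.

Lemma sqr_l2norm_restrC T v :
  l2norm (restr T v) ^+ 2 + l2norm (restr (~: T) v) ^+ 2 = l2norm v ^+ 2.
Proof.
rewrite !sqr_l2norm_restr sqr_l2norm /inner [RHS](bigID (mem T)) /=.
by congr (_ + _); apply: eq_big => j; rewrite ?inE// expr2.
Qed.

(** Cauchy-Schwarz between the indicator of [T] and the absolute values of the entries. *)
Lemma l1norm_le_l2norm T v :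
  l1norm (restr T v) <= Num.sqrt #|T|%:R * l2norm (restr T v).
Proof.
rewrite -(ler_pXn2r (ltn0Sn 1)) ?nnegrE ?l1norm_ge0 ?mulr_ge0 ?sqrtr_ge0 ?l2norm_ge0//.
rewrite exprMn sqr_sqrtr ?ler0n//.
set a : 'cV[R]_p := \col_j (j \in T)%:R; set b : 'cV[R]_p := \col_j `|restr T v j 0|.
have -> : l1norm (restr T v) = inner a b.
  by apply: eq_bigr => j _; rewrite !mxE; case: ifP; rewrite ?mul1r// mul0r normr0.
have -> : #|T|%:R = inner a a.
  rewrite -sum1_card natr_sum big_mkcond; apply: eq_bigr => j _.
  by rewrite !mxE; case: ifP; rewrite ?mul1r ?mul0r.
rewrite (sqr_l2norm (restr T v)).
have -> : inner (restr T v) (restr T v) = inner b b.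
  apply: eq_bigr => j _; rewrite [b j 0]mxE -expr2 -[RHS]expr2.
  by rewrite real_normK ?num_real.
exact: cauchy_schwarz.
Qed.

Lemma supp_restr T v : supp (restr T v) \subset T.
Proof. by apply/fintype.subsetP => j; rewrite inE mxE; case: ifP => // _; rewrite eqxx. Qed.

End Restriction.

(** * Largest entries of a finite family *)

Section LargestEntries.
Context {R : realType} {I : finType}.
Implicit Types (f : I -> R) (A B T U : {set I}).

(** Greedy choice: each step adds a maximizer of [f] over [U :\: T]. *)
Lemma ex_largest_subset f U k : (k <= #|U|)%N ->
  exists T : {set I}, [/\ T \subset U, #|T| = k &
    forall i j, i \in T -> j \in U :\: T -> f j <= f i].
Proof.
elim: k => [|k IH] kU.
  by exists finset.set0; split=> [||i j]; rewrite ?finset.sub0set ?cards0// inE.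
have [T [TU cT topT]] := IH (ltnW kU).
have [i0 i0D] : exists i, i \in U :\: T.
  apply/set0Pn; rewrite -card_gt0 cardsD (finset.setIidPr TU) cT subn_gt0//.
case: (arg_maxP f i0D) => i iD maxi.
have [iU iT] : i \in U /\ i \notin T by apply/finset.setDP.
exists (i |: T)%SET; split=> [||k1 j].
- by rewrite finset.subUset finset.sub1set iU.
- by rewrite cardsU1 iT cT.
- rewrite !inE negb_or => k1T /andP[/andP[ji jT] jU].
  have jD : j \in U :\: T by rewrite inE jT.
  by case/orP: k1T => [/eqP->|k1T]; [exact: maxi|exact: topT].
Qed.

(** The minimum of [f] over [A] separates the two sets. If [A] is empty, so is [B] by cardinality,
    and 0 serves. *)
Lemma ex_threshold f A B : (#|B| <= #|A|)%N -> (forall i, 0 <= f i) ->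
  (forall i j, i \in A -> j \in B -> f j <= f i) ->
  exists2 t, 0 <= t &
    (forall i, i \in A -> t <= f i) /\ (forall j, j \in B -> f j <= t).
Proof.
move=> cBA f0 AB; have [A0|[i0 i0A]] := set_0Vmem A.
  exists 0 => //; split => [i _//|j jB].
  by move: cBA; rewrite A0 cards0 leqn0 cards_eq0 => /eqP B0; rewrite B0 inE in jB.
case: (arg_minP f i0A) => i iA mini; exists (f i) => //.
by split=> j jA; [exact: mini|exact: AB].
Qed.

Lemma ler_sum_threshold f A B t : (#|B| <= #|A|)%N -> 0 <= t ->
  (forall i, i \in A -> t <= f i) -> (forall j, j \in B -> f j <= t) ->
  \sum_(j in B) f j <= \sum_(i in A) f i.
Proof.
move=> cBA t0 tA Bt; apply: (@le_trans _ _ (#|B|%:R * t)).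
  by rewrite mulr_natl -sumr_const; exact: ler_sum.
apply: (@le_trans _ _ (#|A|%:R * t)); first by rewrite ler_wpM2r// ler_nat.
by rewrite mulr_natl -sumr_const; exact: ler_sum.
Qed.

(** The common part of [T] and [B] cancels; a threshold then separates [B :\: T] from [T :\: B],
    which is at least as large. *)
Lemma largest_sum f T B : (#|B| <= #|T|)%N -> (forall i, 0 <= f i) ->
  (forall i j, i \in T -> j \notin T -> f j <= f i) ->
  \sum_(j in B) f j <= \sum_(i in T) f i.
Proof.
move=> cBT f0 topT; rewrite (big_setID T) [leRHS](big_setID B) /= finset.setIC lerD2l.
have cD : (#|B :\: T| <= #|T :\: B|)%N by rewrite !cardsD finset.setIC leq_sub2r.
have [|t t0 [tT Bt]] := ex_threshold f _ _ cD f0; last exact: ler_sum_threshold t0 tT Bt.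
by move=> i j; rewrite !inE => /andP[_ iT] /andP[jT _]; exact: topT.
Qed.

End LargestEntries.

(** * Block decomposition of a tail *)

Section Shelling.
Context {R : realType} {p : nat}.

(* The index set is cut into blocks of m entries of decreasing size; the l2
   norm of each block is at most m^(-1/2) times the l1 norm of its predecessor. *)
Lemma shelling (m : nat) (v : 'cV[R]_p) (U : {set 'I_p}) : (0 < m)%N ->
  exists T : {set 'I_p}, [/\ T \subset U, (#|T| <= m)%N &
    forall (C : R) (phi : 'cV[R]_p -> R), 0 <= C -> phi 0 <= 0 ->
      (forall x y, phi (x + y) <= phi x + phi y) ->
      (forall B : {set 'I_p}, B \subset U :\: T -> (#|B| <= m)%N ->
         phi (restr B v) <= C * l2norm (restr B v)) ->
      phi (restr (U :\: T) v) <= C * (l1norm (restr U v) / Num.sqrt m%:R)].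
Proof.
move=> m0; have sm0 : 0 < Num.sqrt m%:R :> R by rewrite sqrtr_gt0 ltr0n.
have [k cU] := ubnP #|U|; elim: k U cU => // k IH U cU.
have [Um|mU] := leqP #|U| m.
  exists U; rewrite finset.setDv; split => // C phi C0 phi0 _ _.
  have -> : restr finset.set0 v = 0 by apply/colP => j; rewrite !mxE inE.
  by apply: (le_trans phi0); rewrite mulr_ge0// divr_ge0 ?l1norm_ge0// ltW.
have [T [TU cT topT]] := @ex_largest_subset R _ (fun j => `|v j 0|) U m (ltnW mU).
set U' := U :\: T in topT.
have cU' : (#|U'| < k)%N.
  rewrite cardsD (finset.setIidPr TU) cT; apply: leq_trans (_ : #|U| <= k)%N => //.
  by rewrite ltn_subrL m0 (leq_ltn_trans _ mU).
have [T2 [T2U' cT2 IH2]] := IH U' cU'.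
have splitU' : restr U' v = restr T2 v + restr (U' :\: T2) v.
  apply/colP => j; rewrite !mxE [in X in _ + X]inE.
  have [jT2|_] /= := boolP (j \in T2); rewrite ?add0r// addr0.
  by rewrite (fintype.subsetP T2U' j jT2).
(* A level t lies above all entries of [T2] and below all those of [T]. Hence the l2 norm on [T2] is
   at most sqrt m t, while m t is at most the l1 norm on [T], a full block of m entries. *)
have first_block : l2norm (restr T2 v) <= l1norm (restr T v) / Num.sqrt m%:R.
  rewrite ler_pdivlMr//.
  have [||t t0 [tT T2t]] := @ex_threshold R _ (fun j => `|v j 0|) T T2 _ (fun=> normr_ge0 _).
  - by rewrite cT.
  - by move=> i j iT /(fintype.subsetP T2U'); exact: topT.
  apply: (@le_trans _ _ (Num.sqrt m%:R * t * Num.sqrt m%:R)).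
    rewrite ler_pM2r// -(ler_pXn2r (ltn0Sn 1)) ?nnegrE ?l2norm_ge0 ?mulr_ge0 ?sqrtr_ge0//.
    rewrite sqr_l2norm_restr exprMn sqr_sqrtr ?ler0n//.
    apply: (@le_trans _ _ (#|T2|%:R * t ^+ 2)); last first.
      by rewrite ler_wpM2r ?sqr_ge0// ler_nat.
    rewrite mulr_natl -sumr_const; apply: ler_sum => j jT2.
    by rewrite -(real_normK (num_real _)) lerXn2r ?nnegrE ?T2t.
  rewrite mulrAC -expr2 sqr_sqrtr ?ler0n// -cT mulr_natl -sumr_const l1norm_restr.
  exact: ler_sum.
exists T; split => //; first by rewrite cT.
move=> C phi C0 phi0 phiD blocks.
(* The l1 mass of [T] pays for [T2], that of [U'] for all later blocks. Since [T] is chosen before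
   [phi], one [T] can serve both the l2 norm of the tail and its correlation with the head. *)
rewrite -(l1norm_restrD U T v TU) -/U' mulrDl mulrDr {1}splitU'.
apply: (le_trans (phiD _ _)); apply: lerD.
  by apply: (le_trans (blocks _ T2U' cT2)); rewrite ler_wpM2l.
apply: IH2 => // B BU' cB; apply: blocks => //.
exact: fintype.subset_trans BU' (finset.subsetDl _ _).
Qed.

End Shelling.

(** * Sparse eigenvalues, restricted eigenvalues and restricted orthogonality *)

Section Design.
Context {R : realType} {n p : nat}.
Variable X : 'M[R]_(n, p).
Implicit Types (u v : 'cV[R]_p) (m : nat).

Lemma inner_mulmx (v : 'cV[R]_p) (e : 'cV[R]_n) : inner e (X *m v) = inner (X^T *m e) v.
Proof.
rewrite /inner; under eq_bigr do rewrite mxE mulr_sumr.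
rewrite exchange_big; apply: eq_bigr => j _; rewrite mxE mulr_suml.
by apply: eq_bigr => i _; rewrite mxE mulrA [e i 0 * _]mulrC.
Qed.

(** Cauchy-Schwarz row by row, with the Frobenius norm of [X] as constant. It bounds the sparse
    quotients from above and yields an admissible constant for [theta]. *)
Lemma ex_bound_mulmx : exists2 F, 0 <= F & forall v, l2norm (X *m v) <= F * l2norm v.
Proof.
pose F2 := \sum_(i < n) inner (row i X)^T (row i X)^T.
have F20 : 0 <= F2 by apply: sumr_ge0 => i _; exact: inner_ge0.
exists (Num.sqrt F2) => [|v]; first exact: sqrtr_ge0.
rewrite -(ler_pXn2r (ltn0Sn 1)) ?nnegrE ?l2norm_ge0 ?mulr_ge0 ?sqrtr_ge0 ?l2norm_ge0//.
rewrite exprMn (sqr_sqrtr F20) (sqr_l2norm v) sqr_l2norm mulr_suml; apply: ler_sum => i _.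
have -> : (X *m v) i 0 = inner (row i X)^T v.
  by rewrite mxE; apply: eq_bigr => j _; rewrite !mxE.
by rewrite -expr2; exact: cauchy_schwarz.
Qed.

Lemma sparse_quotients_ge0 m : lbound (sparse_quotients X m) 0.
Proof.
by move=> _ [v [_ _ ->]]; rewrite divr_ge0 ?sqr_ge0// mulr_ge0 ?ler0n ?sqr_ge0.
Qed.

Lemma sparse_quotients_sub m m' : (m <= m')%N ->
  sparse_quotients X m `<=` sparse_quotients X m'.
Proof.
by move=> mm' _ [v [v0 vm ->]]; exists v; split => //; exact: leq_trans vm mm'.
Qed.

Lemma Lambda_max_ge0 m : 0 <= Lambda_max X m.
Proof.
have [hs|/sup_out Es] := pselect (has_sup (sparse_quotients X m)); last by rewrite /Lambda_max Es.
have [[q qX] ub] := hs.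
exact: le_trans (sparse_quotients_ge0 m q qX) (ub_le_sup ub qX).
Qed.

Lemma card_supp_restr (T : {set 'I_p}) v : (#|supp (restr T v)| <= #|T|)%N.
Proof. exact/subset_leq_card/supp_restr. Qed.

Hypothesis n0 : (0 < n)%N.
Let n0R : 0 < n%:R :> R. Proof. by rewrite ltr0n. Qed.

Lemma has_ubound_sparse_quotients m : has_ubound (sparse_quotients X m).
Proof.
have [F F0 XF] := ex_bound_mulmx; exists (F ^+ 2 / n%:R) => _ [v [v0 _ ->]].
have v2 : 0 < l2norm v ^+ 2 by rewrite exprn_gt0// l2norm_gt0.
rewrite ler_pdivrMr; last by rewrite mulr_gt0.
rewrite mulrA divfK ?gt_eqF// -exprMn.
by rewrite lerXn2r ?nnegrE ?l2norm_ge0 ?mulr_ge0 ?l2norm_ge0 ?XF.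
Qed.

Lemma le_Lambda_max m v : (#|supp v| <= m)%N ->
  l2norm (X *m v) ^+ 2 / n%:R <= Lambda_max X m * l2norm v ^+ 2.
Proof.
move=> vm; have [->|v0] := eqVneq v 0.
  by rewrite mulmx0 !l2norm0 expr0n mul0r mulr0.
have v2 : 0 < l2norm v ^+ 2 by rewrite exprn_gt0// l2norm_gt0.
rewrite -ler_pdivrMr// -mulrA -invfM.
by apply: ub_le_sup; [exact: has_ubound_sparse_quotients|exists v].
Qed.

Lemma ge_Lambda_min m v : (#|supp v| <= m)%N ->
  Lambda_min X m * l2norm v ^+ 2 <= l2norm (X *m v) ^+ 2 / n%:R.
Proof.
move=> vm; have [->|v0] := eqVneq v 0.
  by rewrite mulmx0 !l2norm0 expr0n mul0r mulr0.
have v2 : 0 < l2norm v ^+ 2 by rewrite exprn_gt0// l2norm_gt0.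
rewrite -ler_pdivlMr// -mulrA -invfM.
apply: ge_inf; last by exists v.
by exists 0; exact: sparse_quotients_ge0.
Qed.

(** The infimum decreases as the set grows, provided the smaller set is nonempty: a basis vector
    belongs to it because [0 < p] and [0 < m]. *)
Lemma Lambda_min_antitone m m' : (0 < p)%N -> (0 < m)%N -> (m <= m')%N ->
  Lambda_min X m' <= Lambda_min X m.
Proof.
move=> p0 m0 mm'; pose i := Ordinal p0; apply: lb_le_inf => [|q /(sparse_quotients_sub _ _ mm') qX].
  exists (l2norm (X *m delta_mx i 0) ^+ 2 / (n%:R * l2norm (delta_mx i 0 : 'cV[R]_p) ^+ 2)).
  exists (delta_mx i 0); split => //.
    by apply/eqP => /colP/(_ i)/eqP; rewrite !mxE !eqxx oner_eq0.
  rewrite -(cards1 i) in m0; apply: leq_trans m0; apply/subset_leq_card/fintype.subsetP => j.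
  by rewrite !inE mxE eqxx andbT; case: (j =P i) => // _; rewrite eqxx.
by apply: ge_inf qX; exists 0; exact: sparse_quotients_ge0.
Qed.

Lemma RE_const_ge0 m k0 : RE X m k0 -> 0 <= RE_const X m k0.
Proof. by move=> [_ ?]; rewrite invr_ge0 ltW. Qed.

Lemma RE_bound m k0 (J : {set 'I_p}) v : RE X m k0 -> (#|J| <= m)%N ->
  l1norm (restr (~: J) v) <= k0 * l1norm (restr J v) ->
  l2norm (restr J v) <= RE_const X m k0 * (l2norm (X *m v) / Num.sqrt n%:R).
Proof.
move=> hRE Jm cone.
have rhs0 : 0 <= RE_const X m k0 * (l2norm (X *m v) / Num.sqrt n%:R).
  by rewrite mulr_ge0 ?RE_const_ge0// divr_ge0 ?l2norm_ge0 ?sqrtr_ge0.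
have [->//|vJ0] := eqVneq (l2norm (restr J v)) 0.
have vJ : 0 < l2norm (restr J v) by rewrite lt_def vJ0 l2norm_ge0.
have v0 : v != 0.
  apply: contra vJ0 => /eqP ->; rewrite l2norm_eq0; apply/eqP/colP => j.
  by rewrite !mxE; case: ifP.
case: hRE => _ inf0; rewrite /RE_const ler_pdivlMl// -ler_pdivlMr// -mulrA -invfM.
apply: ge_inf; last by exists J, v.
exists 0 => _ [J' [v' [_ _ _ ->]]].
by rewrite divr_ge0 ?l2norm_ge0// mulr_ge0 ?sqrtr_ge0 ?l2norm_ge0.
Qed.

(** Every admissible constant dominates the quotient by the two norms, hence so does the infimum of
    this nonempty set. When one of the norms vanishes, the Frobenius bound makes the left side 0. *)
Lemma theta_bound m m' (T T' : {set 'I_p}) u v :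
  [disjoint T & T']%B -> (#|T| <= m)%N -> (#|T'| <= m')%N ->
  `|inner (X *m restr T u) (X *m restr T' v)| / n%:R
    <= theta X m m' * l2norm (restr T u) * l2norm (restr T' v).
Proof.
move=> dT Tm Tm'; set a := restr T u; set b := restr T' v.
have [F F0 XF] := ex_bound_mulmx.
have inner_F (x y : 'cV[R]_p) :
    `|inner (X *m x) (X *m y)| / n%:R <= F ^+ 2 / n%:R * l2norm x * l2norm y.
  rewrite ler_pdivrMr//.
  have -> : F ^+ 2 / n%:R * l2norm x * l2norm y * n%:R
      = F * l2norm x * (F * l2norm y) by field; rewrite gt_eqF.
  apply: (le_trans (normr_inner_le _ _)).
  by apply: ler_pM; rewrite ?l2norm_ge0 ?XF.
have [ab0|ab0] := eqVneq (l2norm a * l2norm b) 0.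
  by apply: (le_trans (inner_F _ _)); rewrite -!mulrA ab0 !mulr0.
have ab : 0 < l2norm a * l2norm b by rewrite lt_def ab0 mulr_ge0 ?l2norm_ge0.
rewrite -mulrA -ler_pdivrMr//; apply: lb_le_inf.
  by exists (F ^+ 2 / n%:R) => ? ? ? ? _ _ _; exact: inner_F.
by move=> t /(_ T T' u v dT Tm Tm') tP; rewrite ler_pdivrMr// mulrA.
Qed.

(** Test on two disjoint singletons, available since [1 < p]. *)
Lemma theta_ge0 m m' : (1 < p)%N -> (0 < m)%N -> (0 < m')%N -> 0 <= theta X m m'.
Proof.
move=> p1 m0 m'0; pose i := Ordinal (ltnW p1); pose j := Ordinal p1.
have norm1 (k : 'I_p) : l2norm (restr [set k]%SET (const_mx 1 : 'cV[R]_p)) = 1.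
  apply/eqP; rewrite -(@eqrXn2 _ 2%N) ?l2norm_ge0// sqr_l2norm_restr.
  by rewrite big_set1 mxE !expr1n.
have dij : [disjoint [set i]%SET & [set j]%SET]%B by rewrite disjoints1 inE.
have := theta_bound m m' _ _ (const_mx 1) (const_mx 1) dij.
rewrite !cards1 !norm1 !mulr1 => /(_ m0 m'0); apply: le_trans.
by rewrite divr_ge0.
Qed.

End Design.

(** * First-order optimality of the Lasso and the oracle inequality *)

Section Lasso.
Context {R : realType} {n p : nat}.
Variables (X : 'M[R]_(n, p)) (beta b : 'cV[R]_p) (e : 'cV[R]_n) (lam : R).
Hypotheses (n0 : (0 < n)%N) (lam0 : 0 <= lam).
Hypothesis noise : forall j, `|(X^T *m e) j 0| / n%:R <= lam / 2.
Hypothesis lasso : lasso_solution X (X *m beta + e) lam b.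
Let n0R : 0 < n%:R :> R. Proof. by rewrite ltr0n. Qed.

Lemma l1norm_conv (t : R) (u v : 'cV[R]_p) : 0 <= t -> t <= 1 ->
  l1norm (u + t *: (v - u)) <= (1 - t) * l1norm u + t * l1norm v.
Proof.
move=> t0 t1; rewrite /l1norm !mulr_sumr -big_split /=; apply: ler_sum => j _.
rewrite !mxE.
have -> : u j 0 + t * (v j 0 - u j 0) = (1 - t) * u j 0 + t * v j 0 by ring.
apply: (le_trans (ler_normD _ _)).
by rewrite !normrM (ger0_norm t0) ger0_norm// subr_ge0.
Qed.

(** Minimality is tested at [b + t *: (b' - b)]. Convexity makes the penalty increment at most
    linear in t, so dividing by t leaves only the error t Q, which vanishes as t tends to 0. *)
Lemma lasso_variational (b' : 'cV[R]_p) :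
  inner (X *m beta + e - X *m b) (X *m (b' - b)) / n%:R
    <= lam * (l1norm b' - l1norm b).
Proof.
set r := X *m beta + e - X *m b; set z := X *m (b' - b).
set Q := inner z z / (2 * n%:R).
have Q0 : 0 <= Q by rewrite divr_ge0 ?inner_ge0// mulr_ge0 ?ltW.
have step (t : R) : 0 < t -> t <= 1 ->
    inner r z / n%:R <= lam * (l1norm b' - l1norm b) + t * Q.
  move=> t0 t1; have := lasso (b + t *: (b' - b)); rewrite /lasso_objective.
  have -> : X *m beta + e - X *m (b + t *: (b' - b)) = r - t *: z.
    by rewrite mulmxDr -scalemxAr opprD addrA.
  rewrite -/r; clearbody r z; rewrite !sqr_l2norm !innerE (innerC z r) => H.
  have := ler_wpM2l lam0 (l1norm_conv _ _ _ (ltW t0) t1) => /(_ b b') H1.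
  rewrite -(ler_pM2l t0); have := le_trans H (lerD (lexx _) H1).
  rewrite /Q; move: n0R; set N := n%:R => N0.
  have -> : (2 * N)^-1 = N^-1 / 2 by field; rewrite gt_eqF.
  set rz := inner r z; set zz := inner z z; set rr := inner r r; set Ni := N^-1.
  by move=> H2; apply: le_trans (_ : t * (rz * Ni) <= _) _ => //; lra.
apply/ler_addgt0Pr => eps eps0.
have Q1 : 0 < Q + 1 by rewrite ltr_wpDl.
(* This t makes t Q at most eps; the added 1 covers the case Q = 0. *)
have t0 : 0 < Num.min 1 (eps / (Q + 1)) by rewrite lt_min ltr01 divr_gt0.
apply: (le_trans (step _ t0 _)); first by rewrite ge_min lexx.
rewrite lerD2l.
apply: (@le_trans _ _ (eps / (Q + 1) * Q)).
  by rewrite ler_wpM2r// ge_min lexx orbT.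
by rewrite mulrAC ler_pdivrMr// ler_wpM2l ?ltW// ltrDl.
Qed.

Lemma noise_inner (v : 'cV[R]_p) : inner e (X *m v) / n%:R <= lam / 2 * l1norm v.
Proof.
rewrite inner_mulmx /inner mulr_suml /l1norm mulr_sumr; apply: ler_sum => j _.
apply: (le_trans (ler_norm _)); rewrite !normrM mulrAC normfV (ger0_norm (ltW n0R)).
by rewrite ler_wpM2r.
Qed.

Section Oracle.
Variable J : {set 'I_p}.
Let h := b - restr J beta.
Let A := l2norm (X *m (beta - restr J beta)) ^+ 2 / n%:R.
Let d2 := l2norm (X *m (b - beta)) ^+ 2 / n%:R.
Let nu := l2norm (X *m h) / Num.sqrt n%:R.

Lemma restrC_error : restr (~: J) h = restr (~: J) b.
Proof.
apply/colP => j; rewrite !mxE inE; case: (boolP (j \in J)) => //= jJ.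
by rewrite subr0.
Qed.

(* Keeping the quadratic term lost in the usual basic inequality gives nu^2 on
   the left: 2 <X(b - beta), X h> = |X(b - beta)|^2 + |X h|^2 - |X(beta - beta_J)|^2. *)
Lemma oracle_inequality :
  d2 + nu ^+ 2 + lam * l1norm (restr (~: J) h) <= A + 3 * lam * l1norm (restr J h).
Proof.
have nu2 : nu ^+ 2 = l2norm (X *m h) ^+ 2 / n%:R.
  by rewrite expr_div_n (sqr_sqrtr (ltW n0R)).
have var := lasso_variational (restr J beta).
have noi := noise_inner h.
have l1J : l1norm (restr J beta) <= l1norm (restr J b) + l1norm (restr J h).
  rewrite !l1norm_restr -big_split; apply: ler_sum => j jJ /=.
  by rewrite !mxE jJ -{1}(subKr (b j 0) (beta j 0)); exact: ler_normB.
have := l1norm_restrC J b; rewrite -restrC_error.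
have hh := l1norm_restrC J h.
move: var; have -> : X *m beta + e - X *m b = e - X *m (b - beta).
  by rewrite mulmxBr opprB [X *m beta + e]addrC -addrA.
have -> : X *m (restr J beta - b) = - (X *m h) by rewrite -mulmxN opprB.
have hD : X *m (beta - restr J beta) = X *m h - X *m (b - beta).
  by rewrite -mulmxBr; congr (X *m _); apply/colP => j; rewrite !mxE; ring.
rewrite nu2 /d2 /A hD !sqr_l2norm !innerE (innerC (X *m h) (X *m (b - beta))).
move: noi l1J hh.
set P := l1norm (restr J h); set Q := l1norm (restr (~: J) h).
set B := l1norm (restr J b); set BJ := l1norm (restr J beta).
move=> noi l1J hh var bJ; rewrite -hh in noi; rewrite -bJ in var.
(* After doubling, the noise contributes lam (P + Q) and the penalty 2 lam (P - Q), whose sum is 3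
   lam P - lam Q. *)
have := ler_wpM2l lam0 l1J; move: noi var; rewrite -/P -/Q.
set Ni := n%:R^-1; rewrite -!(mulrC Ni); lra.
Qed.

(** * Bounds inside and outside the cone *)

Section Cone.
Variable m : nat.
Hypotheses (Jm : (#|J| <= m)%N) (hRE : RE X m 6).
Let c := lam * (Num.sqrt m%:R * RE_const X m 6).

(** Passing from l1 to l2 on [J] costs sqrt m, and RE bounds the l2 norm on [J] by K nu. *)
Lemma oracle_cone : l1norm (restr (~: J) h) <= 6 * l1norm (restr J h) ->
  lam * l1norm (restr J h) <= c * nu.
Proof.
move=> cone; rewrite /c -mulrA ler_wpM2l// -mulrA.
apply: (le_trans (l1norm_le_l2norm J h)); apply: ler_pM; rewrite ?sqrtr_ge0 ?l2norm_ge0//.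
  by rewrite ler_sqrt ?ler0n// ler_nat.
exact: RE_bound.
Qed.

(** Here 3 lam P is at most lam Q / 2, with P and Q the l1 norms of h on [J] and off it. Half of lam
    Q thus stays on the left of the oracle inequality, and P is at most Q / 6. *)
Lemma oracle_notcone : 6 * l1norm (restr J h) < l1norm (restr (~: J) h) ->
  [/\ d2 <= A, nu ^+ 2 <= A, lam * l1norm (restr (~: J) h) <= 2 * A &
      lam * l1norm (restr J h) <= A / 3].
Proof.
move=> /ltW/(ler_wpM2l lam0); have := oracle_inequality.
have : 0 <= lam * l1norm (restr J h) by rewrite mulr_ge0 ?l1norm_ge0.
have : 0 <= d2 by rewrite divr_ge0 ?sqr_ge0 ?ltW.
have := sqr_ge0 nu.
move: (l1norm _) (l1norm _) => P Q.
clearbody A d2 nu => ? ? ? ? ?.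
by split; lra.
Qed.

Lemma oracle_prediction : d2 <= A + 9 / 4 * c ^+ 2.
Proof.
have [cone|/oracle_notcone[H _ _ _]] :=
  leP (l1norm (restr (~: J) h)) (6 * l1norm (restr J h)); last first.
  by have := sqr_ge0 c; lra.
have := oracle_cone cone; have := oracle_inequality.
have : 0 <= lam * l1norm (restr (~: J) h) by rewrite mulr_ge0 ?l1norm_ge0.
(* The square gives 3 c nu <= nu^2 + 9/4 c^2, and nu^2 cancels. *)
have := sqr_ge0 (nu - 3 / 2 * c); nra.
Qed.

Lemma oracle_l1 :
  lam * l1norm (restr J h) + lam * l1norm (restr (~: J) h)
    <= 2 * A + Num.max (8 * c ^+ 2) (A / 3).
Proof.
have A0 : 0 <= A by rewrite divr_ge0 ?sqr_ge0 ?ltW.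
have [cone|/oracle_notcone[_ _ H1 H2]] :=
  leP (l1norm (restr (~: J) h)) (6 * l1norm (restr J h)); last first.
  by rewrite [leLHS]addrC lerD// le_max H2 orbT.
apply: (@le_trans _ _ (2 * A + 8 * c ^+ 2)); last by rewrite lerD2l le_max lexx.
have := oracle_cone cone; have := oracle_inequality.
have : 0 <= d2 by rewrite divr_ge0 ?sqr_ge0 ?ltW.
(* Adding lam P to both sides raises its coefficient to 4, and 4 c nu - nu^2 <= 4 c^2. *)
have := sqr_ge0 c; have := sqr_ge0 (nu - 2 * c); nra.
Qed.

Lemma oracle_l1C : lam * l1norm (restr (~: J) h) <= 2 * A + 9 / 2 * c ^+ 2.
Proof.
have A0 : 0 <= A by rewrite divr_ge0 ?sqr_ge0 ?ltW.
have [cone|/oracle_notcone[_ _ H1 _]] :=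
  leP (l1norm (restr (~: J) h)) (6 * l1norm (restr J h)); last first.
  by have := sqr_ge0 c; lra.
have := oracle_cone cone; have := oracle_inequality.
have : 0 <= d2 by rewrite divr_ge0 ?sqr_ge0 ?ltW.
have := sqr_ge0 c; have := sqr_ge0 (nu - 3 / 2 * c); nra.
Qed.

(** Keeping nu^2 leaves a quadratic inequality, which [ler_quadratic] turns into a bound on nu
    itself. *)
Lemma oracle_cone_sq : l1norm (restr (~: J) h) <= 6 * l1norm (restr J h) ->
  nu ^+ 2 <= A + 3 * c * nu.
Proof.
move=> cone; have := oracle_cone cone; have := oracle_inequality.
have : 0 <= lam * l1norm (restr (~: J) h) by rewrite mulr_ge0 ?l1norm_ge0.
have : 0 <= d2 by rewrite divr_ge0 ?sqr_ge0 ?ltW.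
lra.
Qed.

End Cone.
End Oracle.
End Lasso.

(** * The l2 norm of the leading entries *)

Section RestrictedL2.
Context {R : realType} {n p : nat}.
Variables (X : 'M[R]_(n, p)) (m : nat) (J : {set 'I_p}) (v : 'cV[R]_p).
Hypothesis n0 : (0 < n)%N.
Let n0R : 0 < n%:R :> R. Proof. by rewrite ltr0n. Qed.
Let nu := l2norm (X *m v) / Num.sqrt n%:R.

(* RE is also applied to the set of the m largest entries of v, which inherits
   the cone condition from J and dominates every T with at most m elements. *)
Lemma l2norm_cone (T : {set 'I_p}) (k0 : R) : RE X m k0 -> 0 <= k0 ->
  #|J| = m -> [disjoint J & T]%B -> (#|T| <= m)%N ->
  l1norm (restr (~: J) v) <= k0 * l1norm (restr J v) ->
  l2norm (restr (J :|: T) v) ^+ 2 <= 2 * (RE_const X m k0 * nu) ^+ 2.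
Proof.
move=> hRE k00 cJ dJT cT cone.
have Kn0 : 0 <= RE_const X m k0 * nu.
  by rewrite mulr_ge0 ?RE_const_ge0// divr_ge0 ?l2norm_ge0 ?sqrtr_ge0.
have sqb (B : {set 'I_p}) : l2norm (restr B v) <= RE_const X m k0 * nu ->
    l2norm (restr B v) ^+ 2 <= (RE_const X m k0 * nu) ^+ 2.
  by move=> H; rewrite lerXn2r ?nnegrE ?l2norm_ge0.
have [|S [_ cS topS]] := @ex_largest_subset R _ (fun j => `|v j 0|) [set: 'I_p]%SET m.
  by rewrite -cJ cardsT max_card.
have {}topS i j : i \in S -> j \notin S -> `|v j 0| <= `|v i 0|.
  by move=> iS jS; apply: topS; rewrite // inE jS inE.
(* Among sets of m indices [S] carries the most l1 mass, so its complement carries the least. *)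
have JS : l1norm (restr J v) <= l1norm (restr S v).
  by rewrite !l1norm_restr; apply: largest_sum => //; rewrite cJ cS.
have SJ : l1norm (restr (~: S) v) <= l1norm (restr (~: J) v).
  by have := l1norm_restrC S v; rewrite -(l1norm_restrC J v); lra.
have coneS : l1norm (restr (~: S) v) <= k0 * l1norm (restr S v).
  by apply: (le_trans SJ); apply: (le_trans cone); rewrite ler_wpM2l.
have vS := sqb _ (RE_bound X _ _ S v hRE (eq_leq cS) coneS).
have vJ := sqb _ (RE_bound X _ _ J v hRE (eq_leq cJ) cone).
have vT : l2norm (restr T v) ^+ 2 <= l2norm (restr S v) ^+ 2.
  rewrite !sqr_l2norm_restr; apply: largest_sum => [|i|i j iS jS].
  - by rewrite cS.
  - exact: sqr_ge0.
  - rewrite -(real_normK (num_real (v j 0))) -(real_normK (num_real (v i 0))).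
    by rewrite lerXn2r ?nnegrE ?topS.
have -> : l2norm (restr (J :|: T) v) ^+ 2
    = l2norm (restr J v) ^+ 2 + l2norm (restr T v) ^+ 2.
  by rewrite !sqr_l2norm_restr -(bigU _ _ _ dJT); apply: eq_bigl => i; rewrite !inE.
lra.
Qed.

(** Split v into a head w on [J :|: T] and a tail r. With q = |X w|_2 / sqrt n, writing X w = X v -
    X r gives q^2 <= q nu + theta |w|_2 t. Since |w|_2 <= q / sqrt mu, a factor q cancels, and the
    same eigenvalue bound returns from q to |w|_2. *)
Lemma l2norm_sparse_eigenvalue : (0 < m)%N -> (1 < p)%N -> (#|J| <= m)%N ->
  0 < Lambda_min X (2 * m) ->
  exists T : {set 'I_p}, [/\ [disjoint J & T]%B, (#|T| <= m)%N,
    l2norm (restr (~: (J :|: T)) v) <= l1norm (restr (~: J) v) / Num.sqrt m%:R &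
    l2norm (restr (J :|: T) v) <= nu / Num.sqrt (Lambda_min X (2 * m))
      + theta X m (2 * m) * (l1norm (restr (~: J) v) / Num.sqrt m%:R)
          / Lambda_min X (2 * m)].
Proof.
move=> m0 p1 cJ; set mu := Lambda_min X (2 * m) => mu0.
have [T [TJ cT shell]] := shelling m v (~: J) m0.
set t := l1norm _ / _ in shell *; set th := theta _ _ _.
have t0 : 0 <= t by rewrite divr_ge0 ?l1norm_ge0 ?sqrtr_ge0.
have th0 : 0 <= th by apply: theta_ge0; rewrite // muln_gt0.
have nu0 : 0 <= nu by rewrite divr_ge0 ?l2norm_ge0 ?sqrtr_ge0.
have compl : ~: J :\: T = ~: (J :|: T) by rewrite finset.setDE finset.setCU.
rewrite compl in shell.
set w := restr (J :|: T) v; set r := restr (~: (J :|: T)) v.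
have cJT : (#|J :|: T| <= 2 * m)%N.
  by rewrite mul2n -addnn (leq_trans (leq_card_setU _ _))// leq_add.
exists T; split => //.
- by rewrite disjoint_sym finset.disjoints_subset.
- rewrite -[t]mul1r; apply: shell => //; first by rewrite l2norm0.
    exact: l2normD.
  by move=> B _ _; rewrite mul1r.
have cross : `|inner (X *m r) (X *m w)| / n%:R <= th * l2norm w * t.
  (* The correlation with X w is a subadditive functional, and each block is disjoint from
     [J :|: T], so [theta] controls it blockwise. *)
  have := shell (th * l2norm w) (fun x => `|inner (X *m x) (X *m w)| / n%:R).
  apply.
  - by rewrite mulr_ge0 ?l2norm_ge0.
  - by rewrite mulmx0 -(scale0r (X *m w)) innerZl mul0r normr0 mul0r.
  - move=> x y; rewrite mulmxDr innerDl -mulrDl ler_wpM2r ?invr_ge0 ?(ltW n0R)//.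
    exact: ler_normD.
  - move=> B BJT cB; rewrite mulrAC; apply: (theta_bound X n0) => //.
    by rewrite finset.disjoints_subset.
set q := l2norm (X *m w) / Num.sqrt n%:R.
have q0 : 0 <= q by rewrite divr_ge0 ?l2norm_ge0 ?sqrtr_ge0.
have q2 : q ^+ 2 = inner (X *m w) (X *m w) / n%:R.
  by rewrite expr_div_n sqr_l2norm (sqr_sqrtr (ltW n0R)).
have qw : Num.sqrt mu * l2norm w <= q.
  rewrite -(ler_pXn2r (ltn0Sn 1)) ?nnegrE ?mulr_ge0 ?sqrtr_ge0 ?l2norm_ge0//.
  rewrite exprMn (sqr_sqrtr (ltW mu0)) q2 -sqr_l2norm; apply: ge_Lambda_min => //.
  exact: leq_trans (card_supp_restr _ _) cJT.
have smu : 0 < Num.sqrt mu by rewrite sqrtr_gt0.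
have wq : l2norm w <= q / Num.sqrt mu by rewrite ler_pdivlMr// mulrC.
have qle : q ^+ 2 <= q * (nu + th * t / Num.sqrt mu).
  have -> : q ^+ 2 = inner (X *m w) (X *m v) / n%:R - inner (X *m r) (X *m w) / n%:R.
    rewrite q2 -[in RHS](restrC (J :|: T) v) -/w -/r mulmxDr innerDr.
    by rewrite (innerC (X *m w) (X *m r)) mulrDl addrK.
  have first : inner (X *m w) (X *m v) / n%:R <= q * nu.
    rewrite /q /nu mulrACA -invfM -expr2 (sqr_sqrtr (ltW n0R)).
    rewrite ler_wpM2r ?invr_ge0 ?(ltW n0R)//.
    exact: le_trans (ler_norm _) (normr_inner_le _ _).
  have second : - (inner (X *m r) (X *m w) / n%:R) <= q * (th * t / Num.sqrt mu).
    apply: (@le_trans _ _ (th * l2norm w * t)).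
      apply: le_trans cross; rewrite -mulNr ler_wpM2r ?invr_ge0 ?(ltW n0R)//.
      by rewrite -normrN ler_norm.
    have -> : q * (th * t / Num.sqrt mu) = th * (q / Num.sqrt mu) * t by ring.
    by rewrite ler_wpM2r// ler_wpM2l.
  by rewrite mulrDr lerD.
have q_le : q <= nu + th * t / Num.sqrt mu.
  have [->|qn0] := eqVneq q 0.
    by rewrite addr_ge0// divr_ge0 ?sqrtr_ge0// mulr_ge0.
  by rewrite -(@ler_pM2l _ q) ?lt_def ?qn0// -expr2.
apply: (le_trans wq); apply: (@le_trans _ _ ((nu + th * t / Num.sqrt mu) / Num.sqrt mu)).
  by rewrite ler_wpM2r// invr_ge0 ltW.
by rewrite mulrDl -(mulrA (th * t)) -invfM -expr2 (sqr_sqrtr (ltW mu0)).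
Qed.

End RestrictedL2.

(** * Size of beta outside its largest coefficients *)

Section Threshold.
Context {R : realType} {p : nat}.

Lemma largest_threshold (beta : 'cV[R]_p) (lambda sigma : R) (s0 : nat)
    (T0 : {set 'I_p}) : 0 < lambda -> 0 < sigma ->
  is_s0 beta lambda sigma s0 -> largest_locations beta s0 T0 ->
  T0 \subset supp beta /\
  l2norm (restr (~: T0) beta) ^+ 2 <= s0%:R * (lambda * sigma) ^+ 2.
Proof.
move=> l0 sg0 [bnd least] [cT topT]; set t := (lambda * sigma) ^+ 2.
have t0 : 0 < t by rewrite exprn_gt0 ?mulr_gt0.
have tE : lambda ^+ 2 * sigma ^+ 2 = t by rewrite -exprMn.
move: bnd; rewrite -mulrA tE => bnd.
have min0 i : 0 <= Num.min (beta i 0 ^+ 2) t by rewrite le_min sqr_ge0 ltW.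
have minsupp i : i \notin supp beta -> beta i 0 = 0.
  by rewrite inE negbK => /eqP.
split.
  (* If beta vanished at i in [T0], all nonzero locations would lie in [T0 :\ i]. The support size
     is admissible in the definition of [s0], so minimality would give s0 < s0. *)
  apply/fintype.subsetP => i iT; apply/negPn/negP => iS.
  have ST : supp beta \subset T0 :\ i.
    apply/fintype.subsetP => j jS; rewrite !inE; apply/andP; split.
      by apply: contra iS => /eqP <-.
    apply/negPn/negP => jT; have := topT i j iT jT; rewrite (minsupp i iS) normr0.
    by rewrite normr_le0 => /eqP bj; move: jS; rewrite inE bj eqxx.
  have cS : (s0 <= #|supp beta|)%N.
    apply: least; rewrite -mulrA tE (bigID (mem (supp beta))) /=.
    rewrite [X in _ + X]big1 ?addr0; last first.
      by move=> j /minsupp ->; rewrite expr0n/= min_l// ltW.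
    apply: (@le_trans _ _ (\sum_(j in supp beta) t)).
      by apply: ler_sum => j _; rewrite ge_min lexx orbT.
    by rewrite sumr_const mulr_natl.
  have := leq_trans cS (subset_leq_card ST).
  by rewrite -cT (cardsD1 i T0) iT ltnn.
rewrite sqr_l2norm_restr; apply: (le_trans _ bnd).
(* An entry above the level outside [T0] would make s0 + 1 truncated terms equal to t, exceeding the
   total s0 t. Off [T0] the truncation is therefore inactive. *)
have small j : j \notin T0 -> beta j 0 ^+ 2 <= t.
  move=> jT; rewrite leNgt; apply/negP => tj.
  have : t *+ s0.+1 <= s0%:R * t.
    apply: (le_trans _ bnd); rewrite -cT.
    have -> : (#|T0|.+1 = #|j |: T0|)%N by rewrite cardsU1 jT.
    rewrite -sumr_const big_mkcond; apply: ler_sum => i _.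
    case: ifP => [|_]; last exact: min0.
    rewrite !inE => /orP[/eqP->|iT]; rewrite le_min lexx andbT ltW//.
    apply: (lt_le_trans tj); rewrite -(real_normK (num_real (beta j 0))).
    rewrite -(real_normK (num_real (beta i 0))) lerXn2r ?nnegrE//.
    exact: topT.
  by rewrite mulr_natl leNgt mulrS ltrDr t0.
rewrite [leRHS](bigID (mem T0)) /=.
rewrite (eq_bigr (fun j => Num.min (beta j 0 ^+ 2) t)); last first.
  by move=> j; rewrite inE => /small H; rewrite min_l.
rewrite [leLHS](eq_bigl (fun j => j \notin T0)); last by move=> j; rewrite inE.
by rewrite lerDr sumr_ge0.
Qed.

End Threshold.

(** Otherwise x - z > y and x > y, whence x (x - z) > y^2. *)
Lemma ler_quadratic (R : realType) (x y z : R) : 0 <= y ->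
  0 <= z -> x ^+ 2 <= y ^+ 2 + z * x -> x <= y + z.
Proof. by move=> y0 z0 H; rewrite leNgt; apply/negP => xyz; nra. Qed.

Lemma noise_event_coord (R : realType) (n p : nat) (X : 'M[R]_(n, p))
    (sigma a : R) (e : 'cV[R]_n) (j : 'I_p) : noise_event X sigma a e ->
  `|(X^T *m e) j 0| / n%:R <= lambda_noise n p sigma a.
Proof.
rewrite /noise_event /=; apply: le_trans.
rewrite [leRHS]mx_normrE; apply: le_trans (le_bigmax _ _ (j, 0)) => /=.
by rewrite [in leRHS]mxE normrM normfV normr_nat mulrC.
Qed.

(** If lambda were 0, both sides of the condition defining [s0] would vanish and s0 would be 0,
    whereas RE includes 1 <= s0. *)
Lemma RE_threshold_gt0 (R : realType) (n p : nat) (X : 'M[R]_(n, p))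
    (beta : 'cV[R]_p) (lambda sigma k0 : R) (s0 : nat) :
  0 <= lambda -> is_s0 beta lambda sigma s0 -> RE X s0 k0 -> 0 < lambda.
Proof.
move=> l0 [_ least] [s0_gt0 _]; rewrite lt_def l0 andbT; apply/eqP => lE.
have : (s0 <= 0)%N.
  apply: least; rewrite lE expr0n /= !mul0r ?mulr0 ?mul0r.
  by rewrite big1 // => i _; rewrite min_r ?sqr_ge0.
by rewrite leqn0 => /eqP s00; rewrite s00 in s0_gt0.
Qed.

(** * Assembly of the four bounds *)

Theorem theorem5p1 (R : realType) (d : measure_display)
    (Omega : measurableType d) (P : probability Omega R)
    (n p : nat) (hn : (0 < n)%N) (hnp : (n <= p)%N)
    (X : 'M[R]_(n, p))
    (hX : forall j : 'I_p, l2norm (col j X) = Num.sqrt n%:R)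
    (beta : 'cV[R]_p)
    (sigma : R) (hsigma : 0 < sigma)
    (eps : 'I_n -> {RV P >-> R}) (heps : gaussian_noise sigma eps)
    (s0 : nat) (hs0 : is_s0 beta (lambda0 R n p) sigma s0)
    (T0 : {set 'I_p}) (hT0 : largest_locations beta s0 T0)
    (hRE : RE X s0 6)
    (hmin : 0 < Lambda_min X (2 * #|supp beta|))
    (hmax : has_ubound (sparse_quotients X (2 * #|supp beta|)))
    (a : R) (ha : 0 <= a)
    (d0 : R) (hd0 : 2 * Num.sqrt (1 + a) <= d0)
    (w : Omega) (hw : noise_event X sigma a (realization eps w))
    (binit : 'cV[R]_p)
    (hbinit : lasso_solution X (X *m beta + realization eps w)
                (d0 * lambda0 R n p * sigma) binit) :
  let lambda := lambda0 R n p in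
  let lambda_n := d0 * lambda * sigma in
  let S := supp beta in
  let s := #|S| in
  let h := binit - restr T0 beta in
  let Lmax := Lambda_max X (s - s0) in
  let K := RE_const X s0 6 in
  let D0 := D0_cst X s s0 d0 in
  let D1 := D1_cst X s s0 d0 in
  [/\ l2norm (binit - beta) ^+ 2
        <= 2 * lambda ^+ 2 * sigma ^+ 2 * s0%:R * (D0 ^+ 2 + D1 ^+ 2 + 1),
      l1norm (restr T0 h) + l1norm (restr (~: T0)%SET binit)
        <= (2 * Lmax / d0 + Num.max (8 * K ^+ 2 * d0) (Lmax / (3 * d0)))
             * lambda * sigma * s0%:R,
      l2norm (X *m binit - X *m beta) / Num.sqrt n%:R
        <= lambda * sigma * Num.sqrt s0%:R * (Num.sqrt Lmax + 3 * d0 * K) &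
      forall I0 : {set 'I_p}, I0 \subset S -> RE X #|I0| 6 ->
        l2norm (X *m binit - X *m beta) ^+ 2 / n%:R
          <= 2 * l2norm (X *m beta - X *m restr I0 beta) ^+ 2 / n%:R
             + 9 * lambda_n ^+ 2 * #|I0|%:R * RE_const X #|I0| 6 ^+ 2].
Proof.
move=> lambda lambda_n S s h Lmax K D0 D1.
have s0_gt0 : (0 < s0)%N by case: hRE.
have lambda_gt0 : 0 < lambda.
  by apply: (RE_threshold_gt0 R n p X beta lambda sigma 6 s0) => //; exact: sqrtr_ge0.
have d0_gt0 : 2 <= d0.
  apply: le_trans hd0; rewrite ler_peMr// -[leLHS]sqrtr1.
  by rewrite ler_sqrt ?lerDl// addr_ge0.
have d0_pos : 0 < d0 by lra.
have lamn_gt0 : 0 < lambda_n by rewrite !mulr_gt0.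
(* For p = 1 the logarithm, and with it lambda, is 0. *)
have p_gt1 : (1 < p)%N.
  rewrite ltnNge; apply/negP => p1; move: lambda_gt0; rewrite /lambda /lambda0.
  have -> : p = 1%N by apply/eqP; rewrite eqn_leq p1 (leq_trans hn hnp).
  by rewrite ln1 mulr0 mul0r sqrtr0 ltxx.
have [T0S tail] := largest_threshold beta lambda sigma s0 T0 lambda_gt0 hsigma hs0 hT0.
have cT0 : #|T0| = s0 by case: hT0.
have noise j : `|(X^T *m realization eps w) j 0| / n%:R <= lambda_n / 2.
  apply: (le_trans (noise_event_coord R n p X sigma a _ j hw)).
  rewrite /lambda_noise -/lambda /lambda_n.
  have := ler_wpM2r (ltW (mulr_gt0 hsigma lambda_gt0)) hd0; lra.
have lamn_ge0 := ltW lamn_gt0.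
(* The common scale of all bounds: A is at most Lmax g^2 and the constant c of the cone is d0 K
   g. *)
set g := lambda * sigma * Num.sqrt s0%:R.
have sqs0 : 0 < Num.sqrt s0%:R :> R by rewrite sqrtr_gt0 ltr0n.
have s0E : s0%:R = Num.sqrt s0%:R ^+ 2 :> R by rewrite sqr_sqrtr.
have g_gt0 : 0 < g by rewrite !mulr_gt0.
have K0 : 0 <= K by exact: RE_const_ge0.
have L0 : 0 <= Lmax by exact: Lambda_max_ge0.
set A := l2norm (X *m (beta - restr T0 beta)) ^+ 2 / n%:R.
have Ale : A <= Lmax * g ^+ 2.
  (* What remains of beta lives on [S :\: T0], which has s - s0 elements because [T0] lies in
     [S]. *)
  apply: (@le_trans _ _ (Lmax * l2norm (restr (~: T0)%SET beta) ^+ 2)).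
    rewrite /A subr_restr; apply: le_Lambda_max => //.
    rewrite /s -cT0 -[#|T0|](_ : #|S :&: T0| = _); last by rewrite (finset.setIidPr T0S).
    rewrite -cardsD; apply/subset_leq_card/fintype.subsetP => j.
    by rewrite !inE mxE inE; case: (j \in T0) => //=; rewrite eqxx.
  by rewrite ler_wpM2l// (le_trans tail)// /g [leRHS]exprMn -s0E mulrC.
have cE : lambda_n * (Num.sqrt s0%:R * K) = d0 * K * g by rewrite /lambda_n /g; ring.
have nuE (v : 'cV[R]_n) : (l2norm v / Num.sqrt n%:R) ^+ 2 = l2norm v ^+ 2 / n%:R.
  by rewrite expr_div_n [X in _ / X]sqr_sqrtr// ler0n.
have T0_le : (#|T0| <= s0)%N by rewrite cT0.
have pred (m : nat) (J : {set 'I_p}) :=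
  oracle_prediction X beta binit _ lambda_n hn lamn_ge0 noise hbinit J m.
have l1_bound := oracle_l1 X beta binit _ lambda_n hn lamn_ge0 noise hbinit T0 s0 T0_le hRE.
have l1C_bound := oracle_l1C X beta binit _ lambda_n hn lamn_ge0 noise hbinit T0 s0 T0_le hRE.
have hCE : restr (~: T0)%SET h = restr (~: T0)%SET binit := restrC_error beta binit T0.
rewrite cE -/A -/h in l1_bound l1C_bound.
split.
- have mu0 : 0 < Lambda_min X (2 * s0).
    have s0s : (2 * s0 <= 2 * #|supp beta|)%N by rewrite leq_mul2l -cT0 subset_leq_card.
    have s02 : (0 < 2 * s0)%N by rewrite muln_gt0.
    exact: lt_le_trans hmin (Lambda_min_antitone X _ _ (ltnW p_gt1) s02 s0s).
  have [T [dT cT tailT headT]] :=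
    l2norm_sparse_eigenvalue X s0 T0 h hn s0_gt0 p_gt1 T0_le mu0.
  set l1C := l1norm (restr (~: T0)%SET h) in l1C_bound tailT headT.
  set t := l1C / Num.sqrt s0%:R in tailT headT.
  set nu := l2norm (X *m h) / Num.sqrt n%:R in headT.
  have nu0 : 0 <= nu by rewrite divr_ge0 ?l2norm_ge0 ?sqrtr_ge0.
  have tE : lambda_n * l1C = d0 * g * t.
    by rewrite /t /g /lambda_n; field; rewrite gt_eqF.
  have sL0 : 0 <= Num.sqrt Lmax := sqrtr_ge0 _.
  have sLg0 : 0 <= Num.sqrt Lmax * g := mulr_ge0 sL0 (ltW g_gt0).
  have AsL : A <= (Num.sqrt Lmax * g) ^+ 2 by rewrite exprMn (sqr_sqrtr L0).
  have dKg : 0 <= d0 * K * g by rewrite mulr_ge0 ?(ltW g_gt0)// mulr_ge0// ltW.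
  have tD1 : t <= D1 * g.
    rewrite -(ler_pM2l (mulr_gt0 d0_pos g_gt0)) -tE; apply: (le_trans l1C_bound).
    have -> : d0 * g * (D1 * g) = 2 * (Lmax * g ^+ 2) + 9 / 2 * (d0 * K * g) ^+ 2.
      by rewrite /D1 /D1_cst -/K -/Lmax; field; rewrite gt_eqF.
    by rewrite lerD2r ler_pM2l.
  (* The second term of the maximum [D0] is for h in the cone, the first for h outside it. *)
  have head : l2norm (restr (T0 :|: T) h) <= D0 * g.
    have [cone|notcone] := leP l1C (6 * l1norm (restr T0 h)).
      have nu_le : nu <= Num.sqrt Lmax * g + 3 * (d0 * K * g).
        apply: ler_quadratic; [by []|exact: mulr_ge0|].
        have := oracle_cone_sq X beta binit _ lambda_n hn lamn_ge0 noise hbinit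
          T0 s0 T0_le hRE cone.
        by rewrite cE => H; apply: (le_trans H); rewrite lerD2r.
      have := l2norm_cone X s0 T0 h T 6 hRE (ler0n R 6) cT0 dT cT cone => sq.
      apply: (@le_trans _ _ (Num.sqrt 2 * (K * nu))).
        rewrite -(ler_pXn2r (ltn0Sn 1)) ?nnegrE ?l2norm_ge0//; last first.
          by rewrite mulr_ge0 ?sqrtr_ge0// mulr_ge0.
        by rewrite exprMn [Num.sqrt 2 ^+ 2]sqr_sqrtr.
      apply: (@le_trans _ _ (K * Num.sqrt 2 * (2 * Num.sqrt Lmax + 3 * d0 * K) * g)).
        have -> : Num.sqrt 2 * (K * nu) = K * Num.sqrt 2 * nu by ring.
        rewrite -[leRHS]mulrA ler_wpM2l ?mulr_ge0 ?sqrtr_ge0//.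
        apply: (le_trans nu_le).
        (* [D0] carries 2 sqrt Lmax where [nu_le] has 1; the excess is nonnegative. *)
        have -> : (2 * Num.sqrt Lmax + 3 * d0 * K) * g =
          Num.sqrt Lmax * g + 3 * (d0 * K * g) + Num.sqrt Lmax * g by ring.
        by rewrite lerDl.
      by rewrite ler_wpM2r ?(ltW g_gt0)// le_max lexx orbT.
    have [_ nuA l1A _] := oracle_notcone X beta binit _ lambda_n hn lamn_ge0 noise hbinit
      T0 notcone.
    have nu_le : nu <= Num.sqrt Lmax * g.
      by rewrite -(ler_pXn2r (ltn0Sn 1)) ?nnegrE//; exact: le_trans nuA AsL.
    (* Outside the cone d0 g t <= 2 A, and the factor 2 is absorbed by d0 >= 2. *)
    have t_le : t <= Lmax * g.
      rewrite -(ler_pM2l (mulr_gt0 d0_pos g_gt0)) -tE; apply: (le_trans l1A).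
      apply: (@le_trans _ _ (2 * (Lmax * g ^+ 2))); first by rewrite ler_pM2l.
      have -> : d0 * g * (Lmax * g) = d0 * (Lmax * g ^+ 2) by ring.
      by rewrite ler_wpM2r// mulr_ge0// sqr_ge0.
    have th0 : 0 <= theta X s0 (2 * s0) by apply: theta_ge0; rewrite // muln_gt0.
    apply: (le_trans headT); apply: (@le_trans _ _ (D_cst X s s0 * g)); last first.
      by rewrite ler_wpM2r ?(ltW g_gt0)// le_max lexx.
    rewrite /D_cst -/Lmax mulrDl; set mu := Lambda_min X (2 * s0) in mu0 *.
    have smu : 0 < Num.sqrt mu by rewrite sqrtr_gt0.
    apply: lerD.
      have -> : (Num.sqrt 2 + 1) * (Num.sqrt Lmax / Num.sqrt mu) * g =
        (Num.sqrt 2 + 1) * (Num.sqrt Lmax * g / Num.sqrt mu) by ring.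
      apply: (@le_trans _ _ (Num.sqrt Lmax * g / Num.sqrt mu)).
        by rewrite ler_wpM2r// invr_ge0 ltW.
      by rewrite ler_peMl ?lerDr ?sqrtr_ge0// divr_ge0 ?(ltW smu).
    rewrite [leRHS]mulrAC ler_wpM2r ?invr_ge0 ?(ltW mu0)// -mulrA.
    by rewrite ler_wpM2l.
  have h2 : l2norm h ^+ 2 <= g ^+ 2 * (D0 ^+ 2 + D1 ^+ 2).
    rewrite -(sqr_l2norm_restrC (T0 :|: T) h) mulrDr; apply: lerD.
      by rewrite -exprMn [g * _]mulrC lerXn2r ?nnegrE ?l2norm_ge0 ?(le_trans _ head) ?l2norm_ge0.
    have tail_le := le_trans tailT tD1.
    by rewrite -exprMn [g * _]mulrC lerXn2r ?nnegrE ?l2norm_ge0 ?(le_trans _ tail_le) ?l2norm_ge0.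
  (* The coefficients of beta off [T0] account for the final 1 in D0^2 + D1^2 + 1. *)
  have -> : binit - beta = h - restr (~: T0)%SET beta.
    by rewrite -subr_restr /h; apply/colP => j; rewrite !mxE; ring.
  apply: (le_trans (l2normB_sqr _ _)).
  have -> : 2 * lambda ^+ 2 * sigma ^+ 2 * s0%:R * (D0 ^+ 2 + D1 ^+ 2 + 1) =
     2 * (g ^+ 2 * (D0 ^+ 2 + D1 ^+ 2)) + 2 * (s0%:R * (lambda * sigma) ^+ 2).
    by rewrite s0E /g; ring.
  by rewrite lerD// ler_pM2l.
- rewrite -hCE -(ler_pM2l lamn_gt0) mulrDr; apply: (le_trans l1_bound).
  set M := Num.max (8 * K ^+ 2 * d0) (Lmax / (3 * d0)).
  (* Multiplication by lambda_n matches the maxima term by term: M d0 g^2 becomes the larger of 8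
     (d0 K g)^2 and Lmax g^2 / 3. *)
  have -> : lambda_n * ((2 * Lmax / d0 + M) * lambda * sigma * s0%:R)
      = 2 * (Lmax * g ^+ 2) + M * (d0 * g ^+ 2).
    by rewrite s0E /lambda_n /g; field; rewrite gt_eqF.
  have dg : 0 <= d0 * g ^+ 2 by rewrite mulr_ge0 ?sqr_ge0// ltW.
  rewrite lerD ?ler_wpM2l// ge_max; apply/andP; split.
    have -> : 8 * (d0 * K * g) ^+ 2 = 8 * K ^+ 2 * d0 * (d0 * g ^+ 2) by ring.
    by rewrite ler_wpM2r// le_max lexx.
  apply: (@le_trans _ _ (Lmax / (3 * d0) * (d0 * g ^+ 2))).
    have -> : Lmax / (3 * d0) * (d0 * g ^+ 2) = Lmax * g ^+ 2 / 3. by field; rewrite gt_eqF.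
    by rewrite ler_wpM2r// invr_ge0.
  by rewrite ler_wpM2r// le_max lexx orbT.
- rewrite -mulmxBr -(ler_pXn2r (ltn0Sn 1)) ?nnegrE; last 2 first.
  + by rewrite divr_ge0 ?l2norm_ge0 ?sqrtr_ge0.
  + apply: (mulr_ge0 (ltW g_gt0)); apply: (addr_ge0 (sqrtr_ge0 _)).
    by rewrite mulr_ge0// mulr_ge0// ltW.
  rewrite -/g nuE; apply: (le_trans (pred s0 T0 T0_le hRE)).
  rewrite -/K cE -/A.
  (* Expanding the squared target yields Lmax g^2, a cross term and 9 (d0 K g)^2; the oracle bound
     has no cross term and only 9/4. *)
  have cross : 0 <= g ^+ 2 * (Num.sqrt Lmax * (d0 * K)).
    by rewrite mulr_ge0 ?sqr_ge0// mulr_ge0 ?sqrtr_ge0// mulr_ge0// ltW.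
  have sq := sqr_ge0 (d0 * K * g).
  apply: (@le_trans _ _ (Num.sqrt Lmax ^+ 2 * g ^+ 2 + 9 / 4 * (d0 * K * g) ^+ 2)).
    by rewrite (sqr_sqrtr L0) lerD2r.
  move: (Num.sqrt Lmax) cross sq => sL; clearbody g K; lra.
- move=> I0 _ hRE0; rewrite -!mulmxBr.
  apply: (le_trans (pred #|I0| I0 (leqnn _) hRE0)).
  have -> : 9 * lambda_n ^+ 2 * #|I0|%:R * RE_const X #|I0| 6 ^+ 2
      = 9 * (lambda_n * (Num.sqrt #|I0|%:R * RE_const X #|I0| 6)) ^+ 2.
    by rewrite -{1}(sqr_sqrtr (ler0n R #|I0|)); ring.
  rewrite -[2 * _ / _]mulrA; set B := _ / n%:R; set C := (_ * _) ^+ 2.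
  have B0 : 0 <= B by rewrite divr_ge0 ?sqr_ge0 ?ler0n.
  have C0 : 0 <= C by rewrite sqr_ge0.
  by clearbody B C; lra.
Qed.
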